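(* Let $N\geq 1$ and regard $M_N(\mathbb{C})$ as a complex $*$-algebra. Then there is an isomorphism of semigroups $$\operatorname{Pert}(M_N(\mathbb{C})) \cong \left\{ A \in M_{N^2}(\mathbb{C}) \mid A e_1 = e_1,\ \Omega \overline{A} = A \Omega \right\},$$ where $$e_1 = \begin{pmatrix} 1 \\ 0 \\ \vdots \\ 0 \end{pmatrix}\in\mathbb{C}^{N^2}, \qquad \Omega = \begin{pmatrix} I_{N(N+1)/2} & 0 \\ 0 & -I_{N(N-1)/2} \end{pmatrix},$$ $\overline{A}$ is the entrywise complex conjugate of $A$, and the semigroup structure on the right-hand side is matrix multiplication.
   Context: For a complex associative unital $*$-algebra $\mathcal{A}$, the opposite algebra $\mathcal{A}^\circ$ is the vector space $\mathcal{A}$, with elements written $a^\circ$, and product $a^\circ b^\circ=(ba)^\circ$. The perturbation semigroup $\operatorname{Pert}(\mathcal{A})$ is the set of elements of $\mathcal{A}\otimes_{\mathbb{C}}\mathcal{A}^\circ$ of the form $\sum_j a_j\otimes b_j^\circ$ (finite sum) with $\sum_j a_jb_j=1$ and $\sum_j a_j\otimes b_j^\circ=\sum_j b_j^*\otimes a_j^{*\circ}$; it is a unital semigroup under the multiplication of $\mathcal{A}\otimes_{\mathbb{C}}\mathcal{A}^\circ$. The involution on $M_N(\mathbb{C})$ is conjugate transposition. *)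

(* Defs.v *)
From HB Require Import structures.
From mathcomp Require Import all_boot all_order all_algebra.
From mathcomp Require Import sesquilinear boolp reals complex.

Set Implicit Arguments.
Unset Strict Implicit.
Unset Printing Implicit Defensive.

Import Order.TTheory GRing.Theory Num.Theory.
Local Open Scope ring_scope.
Local Open Scope quotient_scope.

Section TensorProduct.
Context {K : comNzRingType}.

Section Modules.
Variables (U V : lmodType K).

Definition fsum_eval (W : lmodType K) (f : U -> V -> W) (s : seq (U * V)) : W :=
  \sum_(p <- s) f p.1 p.2.

(* Two formal sums of pairs represent the same tensor when no bilinear map
   separates them; tensor_lift_pure and tensor_lift_uniq below show that the
   resulting quotient has the universal property of the tensor product. *)
Definition tensor_eq (s t : seq (U * V)) : bool :=
  `[< forall (W : lmodType K) (f : {bilinear U -> V -> W}),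
        fsum_eval f s = fsum_eval f t >].

Lemma tensor_eq_refl : reflexive tensor_eq.
Proof. by move=> s; apply/asboolP. Qed.

Lemma tensor_eq_sym : symmetric tensor_eq.
Proof. by move=> s t; apply/asboolP/asboolP => e W f; rewrite e. Qed.

Lemma tensor_eq_trans : transitive tensor_eq.
Proof.
by move=> t s u /asboolP e1 /asboolP e2; apply/asboolP => W f; rewrite e1.
Qed.

Canonical tensor_equiv :=
  EquivRel tensor_eq tensor_eq_refl tensor_eq_sym tensor_eq_trans.

Definition tensor := {eq_quot tensor_eq}.
HB.instance Definition _ := Choice.on tensor.
HB.instance Definition _ := EqQuotient.on tensor.

Definition tensor_lift (W : lmodType K) (f : U -> V -> W) (x : tensor) : W :=
  fsum_eval f (repr x).

Lemma tensor_liftE (W : lmodType K) (f : {bilinear U -> V -> W}) s :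
  tensor_lift f (\pi_tensor s) = \sum_(p <- s) f p.1 p.2.
Proof.
rewrite /tensor_lift.
have : repr (\pi_tensor s) = s %[mod tensor] by rewrite reprK.
by move/eqmodP/asboolP; apply.
Qed.

Lemma tensorP (x y : tensor) :
  (forall (W : lmodType K) (f : {bilinear U -> V -> W}),
     tensor_lift f x = tensor_lift f y) -> x = y.
Proof.
move=> e; rewrite -[x]reprK -[y]reprK; apply/eqmodP/asboolP => W f.
exact: e.
Qed.

Definition tensor_zero : tensor := \pi_tensor [::].
Definition tensor_add (x y : tensor) : tensor := \pi_tensor (repr x ++ repr y).
Definition tensor_opp (x : tensor) : tensor :=
  \pi_tensor [seq (- p.1, p.2) | p <- repr x].
Definition tensor_scale (k : K) (x : tensor) : tensor :=
  \pi_tensor [seq (k *: p.1, p.2) | p <- repr x].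

Section LiftOperations.
Variables (W : lmodType K) (f : {bilinear U -> V -> W}).

Lemma tensor_lift_zero : tensor_lift f tensor_zero = 0.
Proof. by rewrite tensor_liftE big_nil. Qed.

Lemma tensor_lift_add x y :
  tensor_lift f (tensor_add x y) = tensor_lift f x + tensor_lift f y.
Proof. by rewrite tensor_liftE big_cat. Qed.

Lemma tensor_lift_opp x : tensor_lift f (tensor_opp x) = - tensor_lift f x.
Proof.
rewrite tensor_liftE big_map /= -sumrN.
by apply: eq_bigr => p _; rewrite linearNl.
Qed.

Lemma tensor_lift_scale k x :
  tensor_lift f (tensor_scale k x) = k *: tensor_lift f x.
Proof.
rewrite tensor_liftE big_map /= scaler_sumr.
by apply: eq_bigr => p _; rewrite linearZl_LR.
Qed.

End LiftOperations.

Lemma tensor_addA : associative tensor_add.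
Proof.
by move=> x y z; apply: tensorP => W f; rewrite !tensor_lift_add addrA.
Qed.

Lemma tensor_addC : commutative tensor_add.
Proof.
by move=> x y; apply: tensorP => W f; rewrite !tensor_lift_add addrC.
Qed.

Lemma tensor_add0 : left_id tensor_zero tensor_add.
Proof.
move=> x; apply: tensorP => W f.
by rewrite tensor_lift_add tensor_lift_zero add0r.
Qed.

Lemma tensor_addN : left_inverse tensor_zero tensor_opp tensor_add.
Proof.
move=> x; apply: tensorP => W f.
by rewrite tensor_lift_add tensor_lift_opp tensor_lift_zero addNr.
Qed.

HB.instance Definition _ :=
  GRing.isZmodule.Build tensor tensor_addA tensor_addC tensor_add0 tensor_addN.

Lemma tensor_scaleA a b x :
  tensor_scale a (tensor_scale b x) = tensor_scale (a * b) x.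
Proof. by apply: tensorP => W f; rewrite !tensor_lift_scale scalerA. Qed.

Lemma tensor_scale1 : left_id 1 tensor_scale.
Proof. by move=> x; apply: tensorP => W f; rewrite tensor_lift_scale scale1r. Qed.

Lemma tensor_scaleDr : right_distributive tensor_scale +%R.
Proof.
move=> a x y; apply: tensorP => W f.
by rewrite !(tensor_lift_scale, tensor_lift_add) scalerDr.
Qed.

Lemma tensor_scaleDl x : {morph tensor_scale^~ x : a b / a + b}.
Proof.
move=> a b; apply: tensorP => W f.
by rewrite !(tensor_lift_scale, tensor_lift_add) scalerDl.
Qed.

HB.instance Definition _ := GRing.Zmodule_isLmodule.Build K tensor
  tensor_scaleA tensor_scale1 tensor_scaleDr tensor_scaleDl.

Definition pure (u : U) (v : V) : tensor := \pi_tensor [:: (u, v)].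

Lemma pure_bilinear : bilinear_for *:%R *:%R pure.
Proof.
split=> [v a u1 u2 | u a v1 v2] /=; apply: tensorP => W f.
  rewrite tensor_lift_add tensor_lift_scale !tensor_liftE !big_seq1 /=.
  by rewrite linearPl.
rewrite tensor_lift_add tensor_lift_scale !tensor_liftE !big_seq1 /=.
by rewrite linearPr.
Qed.

HB.instance Definition _ :=
  bilinear_isBilinear.Build K U V tensor *:%R *:%R pure pure_bilinear.

Lemma tensor_lift_linear (W : lmodType K) (f : {bilinear U -> V -> W}) :
  linear (tensor_lift f).
Proof. by move=> k x y; rewrite tensor_lift_add tensor_lift_scale. Qed.

HB.instance Definition _ (W : lmodType K) (f : {bilinear U -> V -> W}) :=
  GRing.isLinear.Build K tensor W *:%R (tensor_lift f) (tensor_lift_linear f).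

Lemma tensor_lift_pure (W : lmodType K) (f : {bilinear U -> V -> W}) u v :
  tensor_lift f (pure u v) = f u v.
Proof. by rewrite tensor_liftE big_seq1. Qed.

Lemma pi_tensorE s : \pi_tensor s = \sum_(p <- s) pure p.1 p.2.
Proof.
apply: tensorP => W f; rewrite tensor_liftE linear_sum.
by apply: eq_bigr => p _; rewrite /= tensor_lift_pure.
Qed.

Lemma tensor_sumP (x : tensor) :
  exists s : seq (U * V), x = \sum_(p <- s) pure p.1 p.2.
Proof. by exists (repr x); rewrite -pi_tensorE reprK. Qed.

Lemma tensor_lift_uniq (W : lmodType K) (f : {bilinear U -> V -> W})
    (g : {linear tensor -> W}) :
  (forall u v, g (pure u v) = f u v) -> g =1 tensor_lift f.
Proof.
move=> gE x; have [s ->] := tensor_sumP x; rewrite !linear_sum.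
by apply: eq_bigr => p _; rewrite gE /= tensor_lift_pure.
Qed.

End Modules.

Section Algebras.
Variables (A B : algType K).
Local Notation T := (tensor A B).

Definition tensor_one : T := pure 1 1.

Definition tensor_mul (x y : T) : T :=
  \pi_T [seq (p.1 * q.1, p.2 * q.2) | p <- repr x, q <- repr y].

Section MulLift.
Variables (W : lmodType K) (f : {bilinear A -> B -> W}).

Definition mul_lift (a : A) (b : B) (c : A) (d : B) : W := f (a * c) (b * d).

Lemma mul_lift_bilinear a b : bilinear_for *:%R *:%R (mul_lift a b).
Proof.
split=> [d k c1 c2 | c k d1 d2]; rewrite /mul_lift /= mulrDr -scalerAr.
  by rewrite linearPl.
by rewrite linearPr.
Qed.

HB.instance Definition _ a b := bilinear_isBilinear.Build K A B W *:%R *:%R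
  (mul_lift a b) (mul_lift_bilinear a b).

Definition mul_lift2 (y : T) (a : A) (b : B) : W := tensor_lift (mul_lift a b) y.

Lemma mul_lift2_bilinear y : bilinear_for *:%R *:%R (mul_lift2 y).
Proof.
split=> [b k a1 a2 | a k b1 b2] /=; rewrite /mul_lift2 /tensor_lift /fsum_eval.
  rewrite scaler_sumr -big_split; apply: eq_bigr => p _.
  by rewrite /mul_lift /= mulrDl -scalerAl linearPl.
rewrite scaler_sumr -big_split; apply: eq_bigr => p _.
by rewrite /mul_lift /= mulrDl -scalerAl linearPr.
Qed.

HB.instance Definition _ y := bilinear_isBilinear.Build K A B W *:%R *:%R
  (mul_lift2 y) (mul_lift2_bilinear y).

Lemma tensor_lift_mul x y :
  tensor_lift f (tensor_mul x y) = tensor_lift (mul_lift2 y) x.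
Proof.
by rewrite tensor_liftE big_allpairs_dep.
Qed.

End MulLift.

Lemma pure_tensor_mul a b c d :
  tensor_mul (pure a b) (pure c d) = pure (a * c) (b * d).
Proof.
apply: tensorP => W f; rewrite tensor_lift_mul [RHS]tensor_lift_pure.
rewrite (tensor_lift_pure (mul_lift2 f (pure c d))) /= /mul_lift2.
exact: (tensor_lift_pure (mul_lift f a b)).
Qed.

Lemma tensor_mulDl : left_distributive tensor_mul +%R.
Proof.
move=> x y z; apply: tensorP => W f; rewrite linearD /= !tensor_lift_mul.
exact: (linearD (tensor_lift (mul_lift2 f z))).
Qed.

Lemma tensor_mulDr : right_distributive tensor_mul +%R.
Proof.
move=> x y z; apply: tensorP => W f; rewrite linearD /= !tensor_lift_mul.
rewrite {1}/tensor_lift /fsum_eval [X in _ = X + _]/tensor_lift /fsum_eval.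
rewrite [X in _ = _ + X]/tensor_lift /fsum_eval -big_split.
apply: eq_bigr => p _; exact: (linearD (tensor_lift (mul_lift f p.1 p.2))).
Qed.

Lemma tensor_mul0l x : tensor_mul 0 x = 0.
Proof. by apply: (addrI (tensor_mul 0 x)); rewrite -tensor_mulDl !addr0. Qed.

Lemma tensor_mul0r x : tensor_mul x 0 = 0.
Proof. by apply: (addrI (tensor_mul x 0)); rewrite -tensor_mulDr !addr0. Qed.

Lemma tensor_mul_suml (s : seq (A * B)) (F : A * B -> T) x :
  tensor_mul (\sum_(p <- s) F p) x = \sum_(p <- s) tensor_mul (F p) x.
Proof.
by apply: (big_morph (tensor_mul^~ x)); [move=> y z; exact: tensor_mulDl|
  exact: tensor_mul0l].
Qed.

Lemma tensor_mul_sumr (s : seq (A * B)) (F : A * B -> T) x :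
  tensor_mul x (\sum_(p <- s) F p) = \sum_(p <- s) tensor_mul x (F p).
Proof.
by apply: (big_morph (tensor_mul x)); [move=> y z; exact: tensor_mulDr|
  exact: tensor_mul0r].
Qed.

Lemma tensor_mulA : associative tensor_mul.
Proof.
move=> x y z; have [r ->] := tensor_sumP x; have [s ->] := tensor_sumP y.
have [t ->] := tensor_sumP z; rewrite !tensor_mul_suml.
apply: eq_bigr => p _; rewrite !(tensor_mul_sumr s).
rewrite tensor_mul_suml; apply: eq_bigr => q _; rewrite !tensor_mul_sumr; apply: eq_bigr => u _.
by rewrite !pure_tensor_mul !mulrA.
Qed.

Lemma tensor_mul1 : left_id tensor_one tensor_mul.
Proof.
move=> x; have [s ->] := tensor_sumP x; rewrite tensor_mul_sumr.
by apply: eq_bigr => p _; rewrite pure_tensor_mul !mul1r.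
Qed.

Lemma tensor_mulr1 : right_id tensor_one tensor_mul.
Proof.
move=> x; have [s ->] := tensor_sumP x; rewrite tensor_mul_suml.
by apply: eq_bigr => p _; rewrite pure_tensor_mul !mulr1.
Qed.

(* Only a pzRingType: 1 = 0 is not excluded over a general ring K. *)
HB.instance Definition _ := GRing.Zmodule_isPzRing.Build T
  tensor_mulA tensor_mul1 tensor_mulr1 tensor_mulDl tensor_mulDr.

Lemma pureM (a c : A) (b d : B) :
  (pure a b : T) * (pure c d : T) = pure (a * c) (b * d).
Proof. exact: pure_tensor_mul. Qed.

End Algebras.
End TensorProduct.

Notation "U ⊗ V" := (tensor U V) (at level 40, left associativity) : type_scope.
Notation "u ⊗ v" := (pure u v) (at level 40, left associativity) : ring_scope.

Section OppositeAlgebra.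
Variables (K : comNzRingType) (A : algType K).

HB.instance Definition _ := GRing.Lmodule.copy A^c A.

(* Without the casts to A^c the product would be elaborated in A, to which A^c
   is convertible. *)
Lemma converse_scaleAl (k : K) (a b : A^c) : k *: (a * b) = (k *: a : A^c) * b.
Proof. exact: (@scalerAr K A k b a). Qed.

HB.instance Definition _ :=
  GRing.LSemiModule_isLSemiAlgebra.Build K A^c converse_scaleAl.

Lemma converse_scaleAr (k : K) (a b : A^c) : k *: (a * b) = a * (k *: b : A^c).
Proof. exact: (@scalerAl K A k b a). Qed.

HB.instance Definition _ :=
  GRing.LSemiAlgebra_isSemiAlgebra.Build K A^c converse_scaleAr.

Definition op (a : A) : A^c := a.

Lemma opM a b : op a * op b = op (b * a). Proof. by []. Qed.

Lemma pure_opM (a b c d : A) :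
  (pure a (op b) : A ⊗ A^c) * pure c (op d) = pure (a * c) (op (d * b)).
Proof. exact: pureM. Qed.

End OppositeAlgebra.

Notation "a °" := (op a) (at level 2, format "a °") : ring_scope.

HB.mixin Record Algebra_isStar (K : numClosedFieldType) A
    of GRing.Algebra K A := {
  star : A -> A;
  starK : involutive star;
  starD : {morph star : a b / a + b};
  starZ : forall (k : K) (a : A), star (k *: a) = k^* *: star a;
  starM : forall a b : A, star (a * b) = star b * star a
}.

#[short(type="starAlgType")]
HB.structure Definition StarAlgebra (K : numClosedFieldType) :=
  {A of Algebra_isStar K A & GRing.Algebra K A}.

Section MatrixStar.
Variables (K : numClosedFieldType) (n : nat).
Implicit Types A B : 'M[K]_n.+1.

Definition mx_star A : 'M[K]_n.+1 := (map_mx Num.conj A)^T.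

Lemma mx_starK : involutive mx_star.
Proof. by move=> A; apply/matrixP => i j; rewrite !mxE conjCK. Qed.

Lemma mx_starD : {morph mx_star : A B / A + B}.
Proof. by move=> A B; apply/matrixP => i j; rewrite !mxE rmorphD. Qed.

Lemma mx_starZ (k : K) A : mx_star (k *: A) = k^* *: mx_star A.
Proof. by apply/matrixP => i j; rewrite !mxE rmorphM. Qed.

Lemma mx_starM A B : mx_star (A * B) = mx_star B * mx_star A.
Proof. by rewrite -!mulmxE /mx_star map_mxM trmx_mul. Qed.

HB.instance Definition _ := Algebra_isStar.Build K 'M[K]_n.+1
  mx_starK mx_starD mx_starZ mx_starM.

End MatrixStar.

Section PerturbationSemigroup.
Variables (K : numClosedFieldType) (A : starAlgType K).

Definition in_pert (t : (A ⊗ A^c)%type) : Prop :=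
  exists s : seq (A * A),
    [/\ t = \sum_(p <- s) p.1 ⊗ p.2°,
        \sum_(p <- s) p.1 * p.2 = 1
      & t = \sum_(p <- s) star p.2 ⊗ (star p.1)°].

Lemma star1 : star (1 : A) = 1.
Proof. by rewrite -[LHS]mulr1 -[X in _ * X = _]starK -starM mulr1 starK. Qed.

Lemma in_pert1 : in_pert 1.
Proof.
exists [:: (1, 1)]; rewrite !big_seq1 /= mulr1 star1.
by split.
Qed.

Lemma in_pertM t u : in_pert t -> in_pert u -> in_pert (t * u).
Proof.
move=> [r [rE r1 rS]] [s [sE s1 sS]].
exists [seq (p.1 * q.1, q.2 * p.2) | p <- r, q <- s]; split.
- rewrite rE sE big_distrl big_allpairs_dep; apply: eq_bigr => p _.
  by rewrite big_distrr; apply: eq_bigr => q _; rewrite /= pureM.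
- rewrite big_allpairs_dep -[RHS]r1; apply: eq_bigr => p _ /=.
  rewrite -[in RHS](mul1r p.2) -s1 mulr_suml mulr_sumr.
  by apply: eq_bigr => q _; rewrite !mulrA.
- rewrite rS sS big_distrl big_allpairs_dep; apply: eq_bigr => p _.
  by rewrite big_distrr; apply: eq_bigr => q _; rewrite /= pureM opM /= !starM.
Qed.

Record Pert :=
  MkPert { pert_val :> (A ⊗ A^c)%type; _ : `[< in_pert pert_val >] }.

HB.instance Definition _ := [isSub for pert_val].
HB.instance Definition _ := [Choice of Pert by <:].

Lemma pertP (t : Pert) : in_pert t.
Proof. exact: (asboolW (valP t)). Qed.

Definition pert_one : Pert := MkPert (asboolT in_pert1).
Definition pert_mul (t u : Pert) : Pert :=
  MkPert (asboolT (in_pertM (pertP t) (pertP u))).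

Lemma pert_mulA : associative pert_mul.
Proof. by move=> t u v; apply: val_inj; rewrite /= mulrA. Qed.

Lemma pert_mul1 : left_id pert_one pert_mul.
Proof. by move=> t; apply: val_inj; rewrite /= mul1r. Qed.

Lemma pert_mulr1 : right_id pert_one pert_mul.
Proof. by move=> t; apply: val_inj; rewrite /= mulr1. Qed.

HB.instance Definition _ :=
  isMonoid.Build Pert pert_mulA pert_mul1 pert_mulr1.

End PerturbationSemigroup.

Section MatrixSemigroup.
Variables (K : numClosedFieldType) (N : nat).

Lemma half_split : ((N * N.+1)./2 + (N * N.-1)./2 = N ^ 2)%N.
Proof.
have e : (N * N.+1 = N.*2 + N * N.-1)%N.
  by case: N => // m; rewrite /= -muln2 -mulnDr.
have o : ~~ odd (N * N.-1) by rewrite oddM; case: N => //= m; rewrite andNb.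
rewrite e halfD odd_double add0n doubleK -addnA addnn even_halfK //.
by case: N => // m; rewrite /= -[X in (X + _)%N]muln1 -mulnDr.
Qed.

Definition e1 : 'cV[K]_(N ^ 2) := \col_i (i == 0 :> nat)%:R.

Definition Omega : 'M[K]_(N ^ 2) :=
  castmx (half_split, half_split) (block_mx 1%:M 0 0 (- 1%:M)).

Lemma OmegaE i j :
  Omega i j = (-1) ^+ ((N * N.+1)./2 <= i)%N * (i == j)%:R.
Proof.
rewrite castmxE -(inj_eq (@cast_ord_inj _ _ (esym half_split))).
rewrite -[val i]/(val (cast_ord (esym half_split) i)).
move: (cast_ord _ i) (cast_ord _ j) => {}i {}j.
case: (split_ordP i) => i' ->; case: (split_ordP j) => j' -> /=.
- by rewrite block_mxEul mxE eq_lshift leqNgt ltn_ord mul1r.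
- by rewrite block_mxEur mxE eq_lrshift mulr0.
- by rewrite block_mxEdl mxE eq_rlshift mulr0.
- by rewrite block_mxEdr !mxE eq_rshift leq_addr mulN1r.
Qed.

Definition in_mxpert (A : 'M[K]_(N ^ 2)) : bool :=
  (A *m e1 == e1) && (Omega *m map_mx Num.conj A == A *m Omega).

Lemma in_mxpert1 : in_mxpert 1%:M.
Proof. by rewrite /in_mxpert mul1mx map_mx1 mulmx1 mul1mx !eqxx. Qed.

Lemma in_mxpertM A B : in_mxpert A -> in_mxpert B -> in_mxpert (A *m B).
Proof.
move=> /andP[/eqP eA /eqP oA] /andP[/eqP eB /eqP oB]; apply/andP; split.
  by rewrite -mulmxA eB eA.
by rewrite map_mxM mulmxA oA -mulmxA oB mulmxA.
Qed.

Record MxPert :=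
  MkMxPert { mxpert_val :> 'M[K]_(N ^ 2); _ : in_mxpert mxpert_val }.

HB.instance Definition _ := [isSub for mxpert_val].
HB.instance Definition _ := [Choice of MxPert by <:].

Definition mxpert_one : MxPert := MkMxPert in_mxpert1.
Definition mxpert_mul (A B : MxPert) : MxPert :=
  MkMxPert (in_mxpertM (valP A) (valP B)).

Lemma mxpert_mulA : associative mxpert_mul.
Proof. by move=> A B C; apply: val_inj; rewrite /= mulmxA. Qed.

Lemma mxpert_mul1 : left_id mxpert_one mxpert_mul.
Proof. by move=> A; apply: val_inj; rewrite /= mul1mx. Qed.

Lemma mxpert_mulr1 : right_id mxpert_one mxpert_mul.
Proof. by move=> A; apply: val_inj; rewrite /= mulmx1. Qed.

HB.instance Definition _ :=
  isMonoid.Build MxPert mxpert_mulA mxpert_mul1 mxpert_mulr1.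

End MatrixSemigroup.

(* Main.v *)
(**
A tensor [\sum a ⊗ b°] acts on [M_N] by [v |-> \sum a v b], and this identifies
[M_N ⊗ M_N°] with the algebra of all endomorphisms of [M_N]: since
[\sum_k E_ki v E_jk = v_ij 1], every endomorphism [phi] is the action of
[\sum_ijk phi(E_ij) E_ki ⊗ E_jk°].  The two conditions defining [Pert] say that
[phi] fixes the identity matrix and commutes with the involution.  Choose a
basis of [M_N] whose first vector is the identity matrix, whose first
[N (N + 1) / 2] vectors are hermitian and whose other vectors are
antihermitian: in coordinates the identity is [e1] and the involution is
[c |-> Omega (conj c)], so the conditions become those on the right-hand side.
*)
Require Import Defs.
From HB Require Import structures.
From mathcomp Require Import all_boot all_order all_algebra.
From mathcomp Require Import reals complex.
From mathcomp Require Import sesquilinear boolp ring.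

Set Implicit Arguments.
Unset Strict Implicit.
Unset Printing Implicit Defensive.

Import Order.TTheory GRing.Theory Num.Theory.
Local Open Scope ring_scope.

(** * Bases of eigenvectors of an antilinear involution, with prescribed signs *)

Section SignedBasis.
Variables (K : numClosedFieldType) (V : vectType K) (J : V -> V).

(* If [J v = v] then [J ('i *: v) = - 'i *: v], so the fixed vectors of [J], and
   likewise its antifixed vectors, span [V]; hence the signs in
   [sign_eigenbasis] below can be prescribed at will. *)
Lemma sign_eigenvectors_span (b : bool) (U : {vspace V}) :
    {morph J : u v / u + v} -> (forall (k : K) v, J (k *: v) = k^* *: J v) ->
    involutive J ->
  (forall v, J v = (-1) ^+ b *: v -> v \in U) -> U = fullv.
Proof.
move=> JD JZ JK HU; apply/eqP; rewrite eqEsubv subvf; apply/subvP => v _.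
pose s : K := (-1) ^+ b.
have ss : s * s = 1 by rewrite -expr2 sqrr_sign.
have sJ : s^* = s by rewrite rmorph_sign.
have s2 : (2 : K) != 0 by rewrite pnatr_eq0.
(* Both [v + s *: J v] and ['i *: (v - s *: J v)] are eigenvectors of sign [s], the second because
   [J] conjugates ['i]. *)
have -> : v = 2^-1 *: ((v + s *: J v) - 'i *: ('i *: (v - s *: J v))).
  rewrite scalerA -expr2 sqrCi scaleN1r opprK addrACA subrr addr0 -mulr2n.
  by rewrite -scaler_nat scalerA mulVf ?scale1r.
apply: memvZ; apply: memvB; last apply: memvZ; apply: HU.
  by rewrite JD JZ JK sJ -/s scalerDr scalerA ss scale1r addrC.
rewrite -scaleNr JZ JD JZ JK conjCi rmorphN /= sJ -/s !scalerDr !scalerA.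
rewrite addrC; congr (_ *: _ + _ *: _); first by ring.
by rewrite mulrN -mulrA mulrCA ss mulr1.
Qed.

(** A free family of eigenvectors that does not yet span [V] misses some eigenvector of the next
    required sign, which is appended. *)
Lemma sign_eigenbasis (sgn : nat -> bool) (v0 : V) :
    {morph J : u v / u + v} -> (forall (k : K) v, J (k *: v) = k^* *: J v) ->
    involutive J -> v0 != 0 -> J v0 = (-1) ^+ sgn 0 *: v0 ->
  exists X : (\dim {:V}).-tuple V,
    [/\ basis_of fullv X, X`_0 = v0
      & forall i, (i < \dim {:V})%N -> J X`_i = (-1) ^+ sgn i *: X`_i].
Proof.
move=> JD JZ JK v0n0 Jv0.
have step k : (k < \dim {:V})%N -> exists s : seq V,
    [/\ free s, size s = k.+1, s`_0 = v0
      & forall i, (i <= k)%N -> J s`_i = (-1) ^+ sgn i *: s`_i].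
  elim: k => [_|k IH ltk].
    exists [:: v0]; split=> // [|[]//].
    by rewrite free_cons span_nil memv0 v0n0 nil_free.
  have [s [fs sz s0 sJ]] := IH (ltnW ltk).
  have [v [Jv vs]] : exists v, J v = (-1) ^+ sgn k.+1 *: v /\ v \notin <<s>>%VS.
    apply: contrapT => nex.
    have sV : <<s>>%VS = fullv.
      apply: (sign_eigenvectors_span (b := sgn k.+1) JD JZ JK) => v Jv.
      by apply: contrapT => /negP vs; apply: nex; exists v.
    by move: (dim_span s); rewrite sV sz leqNgt ltk.
  exists (rcons s v); split.
  - by rewrite (perm_free (Y := v :: s)) ?perm_rcons // free_cons vs.
  - by rewrite size_rcons sz.
  - by rewrite nth_rcons sz.
  move=> i; rewrite leq_eqVlt nth_rcons sz ltnS => /orP[/eqP -> | ltik].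
    by rewrite ltnn eqxx.
  by rewrite ltik; apply: sJ.
(* [step k] yields [k.+1] vectors, so the basis comes from [step] at [(\dim {:V}).-1]. *)
have dV : (0 < \dim {:V})%N.
  rewrite lt0n dimv_eq0; apply: contra v0n0 => /eqP V0.
  by rewrite -memv0 -V0 memvf.
have [|s [fs sz s0 sJ]] := step (\dim {:V}).-1; first by rewrite prednK.
have sz' : size s == \dim {:V} by rewrite sz prednK.
exists (Tuple sz'); split=> // [|i lti].
  by rewrite basisEfree fs subvf /= (eqP sz').
by apply: sJ; rewrite -ltnS prednK.
Qed.

End SignedBasis.

(** * Products with matrix units *)

Section MatrixUnits.
Variables (K : comNzRingType) (n : nat).
Implicit Type A : 'M[K]_n.+1.

Lemma delta_mx_mul_delta_mx A i j k l :
  delta_mx i j * A * delta_mx k l = A j k *: delta_mx i l.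
Proof.
(* Each unit is split as a column times a row through ['I_1]; the middle product is then the 1 × 1
   matrix [A j k]. *)
rewrite -!mulmxE -(mul_delta_mx (0 : 'I_1) i j) -(mul_delta_mx (0 : 'I_1) k l).
rewrite -!mulmxA.
rewrite (mulmxA A) -colE (mulmxA _ (col k A)) -rowE [row _ _]mx11_scalar !mxE.
by rewrite mul_scalar_mx -scalemxAr mul_delta_mx.
Qed.

Lemma sum_delta_mx_mul_delta_mx A i j :
  \sum_k delta_mx k i * A * delta_mx j k = (A i j)%:M.
Proof.
under eq_bigr do rewrite delta_mx_mul_delta_mx.
by rewrite -scaler_sumr -mx1_sum_delta scalemx1.
Qed.

End MatrixUnits.

(** * Tensors as matrices of endomorphisms of [M] *)

Section SandwichMatrix.
Variables (K : numClosedFieldType) (n m : nat) (X : m.-tuple 'M[K]_n.+1).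
Local Notation M := 'M[K]_n.+1.

Definition colvec (v : M) : 'cV[K]_m := \col_i coord X i v.
Definition colval (c : 'cV[K]_m) : M := \sum_i c i 0 *: X`_i.

Lemma colvec_linear : linear colvec.
Proof. by move=> k u v; apply/matrixP => i j; rewrite !mxE linearP. Qed.

HB.instance Definition _ :=
  GRing.isLinear.Build K M 'cV[K]_m *:%R colvec colvec_linear.

(** The cast makes the last product that of [M]; in [M^c] it would be reversed. *)
Definition sandwich (a : M) (b : M^c) : 'M[K]_m :=
  \matrix_(i, j) coord X i (a * X`_j * (b : M)).

Lemma sandwich_bilinear : bilinear_for *:%R *:%R sandwich.
Proof.
split=> [b k a1 a2 | a k b1 b2]; apply/matrixP => i j; rewrite !mxE -linearP.
  by rewrite !mulrDl -!scalerAl.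
by rewrite mulrDr -scalerAr.
Qed.

HB.instance Definition _ := bilinear_isBilinear.Build K M M^c 'M[K]_m *:%R *:%R
  sandwich sandwich_bilinear.

Definition tensor_mx (t : (M ⊗ M^c)%type) : 'M[K]_m := tensor_lift sandwich t.

HB.instance Definition _ := GRing.isLinear.Build K (M ⊗ M^c)%type 'M[K]_m *:%R
  tensor_mx (tensor_lift_linear sandwich).

Lemma tensor_mx_pure (a b : M) : tensor_mx (a ⊗ b°) = sandwich a b.
Proof. exact: tensor_lift_pure. Qed.

Definition mx_tensor (A : 'M[K]_m) : (M ⊗ M^c)%type :=
  \sum_i \sum_j \sum_k
    (colval (A *m colvec (delta_mx i j)) * delta_mx k i) ⊗ (delta_mx j k)°.

Context (bX : basis_of fullv X).

Lemma colvecK : cancel colvec colval.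
Proof.
move=> v; rewrite [RHS](coord_basis bX (memvf v)).
by apply: eq_bigr => i _; rewrite mxE.
Qed.

Lemma colvalK : cancel colval colvec.
Proof.
move=> c; apply/matrixP => i j; rewrite mxE ord1.
by rewrite coord_sum_free // (basis_free bX).
Qed.

(** Since [colvec] is onto, matrix identities can be checked as identities of maps on [M]. *)
Lemma colvec_inj_mx (A B : 'M[K]_m) :
  (forall v, A *m colvec v = B *m colvec v) -> A = B.
Proof.
move=> AB; apply/matrixP => i j.
have /matrixP/(_ i 0) := AB (colval (delta_mx j 0)).
by rewrite colvalK -!colE !mxE.
Qed.

Lemma sandwich_colvec (a b v : M) :
  sandwich a b *m colvec v = colvec (a * v * b).
Proof.
apply/matrixP => i j; rewrite !mxE [in RHS](coord_basis bX (memvf v)).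
rewrite mulr_sumr mulr_suml linear_sum; apply: eq_bigr => k _.
by rewrite !mxE -scalerAr -scalerAl linearZ mulrC.
Qed.

Lemma tensor_mx_sum_colvec (s : seq (M * M)) v :
  tensor_mx (\sum_(p <- s) p.1 ⊗ p.2°) *m colvec v =
  colvec (\sum_(p <- s) p.1 * v * p.2).
Proof.
rewrite linear_sum mulmx_suml linear_sum; apply: eq_bigr => p _.
by rewrite /= tensor_mx_pure sandwich_colvec.
Qed.

(** The reversed product of [M^c] matches composition: [a (c v d) b = (a c) v (d b)]. *)
Lemma tensor_mxM t u : tensor_mx (t * u) = tensor_mx t *m tensor_mx u.
Proof.
have [r ->] := tensor_sumP t; have [s ->] := tensor_sumP u.
rewrite big_distrl linear_sum [X in X *m _]linear_sum mulmx_suml; apply: eq_bigr => p _.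
rewrite big_distrr linear_sum [X in _ *m X]linear_sum mulmx_sumr; apply: eq_bigr => q _ /=.
rewrite pure_opM !tensor_mx_pure; apply: colvec_inj_mx => v.
by rewrite -mulmxA !sandwich_colvec !mulrA.
Qed.

(** For [a ⊗ b°] one has [a E_ij b E_ki = b_jk a E_ii]; summing over [j, k] rebuilds [b], and the
    [E_ii] sum to 1. *)
Lemma tensor_mxK : cancel tensor_mx mx_tensor.
Proof.
move=> t; have [s ->] := tensor_sumP t; rewrite /mx_tensor.
transitivity (\sum_i \sum_j \sum_k \sum_(p <- s)
    (p.1 * (p.2 j k *: delta_mx i i)) ⊗ (delta_mx j k)° : (M ⊗ M^c)%type).
  do 3 (apply: eq_bigr => ? _).
  rewrite tensor_mx_sum_colvec colvecK mulr_suml linear_sumlz.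
  by apply: eq_bigr => p _; rewrite -!mulrA (mulrA _ p.2) delta_mx_mul_delta_mx.
under eq_bigr do under eq_bigr do rewrite exchange_big.
under eq_bigr do rewrite exchange_big.
rewrite exchange_big; apply: eq_bigr => -[a b] _ /=.
transitivity (\sum_i (a * delta_mx i i) ⊗ b : (M ⊗ M^c)%type).
  apply: eq_bigr => i _; rewrite [b in RHS](@matrix_sum_delta K).
  rewrite linear_sumr; apply: eq_bigr => j _.
  rewrite linear_sumr; apply: eq_bigr => k _.
  by rewrite -scalerAr linearZl_LR linearZr_LR.
by rewrite -linear_sumlz -mulr_sumr -mx1_sum_delta mulr1.
Qed.

Lemma mx_tensorK : cancel mx_tensor tensor_mx.
Proof.
move=> A; apply: colvec_inj_mx => v.
rewrite [v in RHS]matrix_sum_delta /mx_tensor linear_sum mulmx_suml.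
rewrite [in RHS]linear_sum mulmx_sumr; apply: eq_bigr => i _.
rewrite linear_sum mulmx_suml [in RHS]linear_sum mulmx_sumr.
apply: eq_bigr => j _; rewrite linear_sum mulmx_suml /=.
under eq_bigr => k _.
  rewrite tensor_mx_pure sandwich_colvec -!mulrA.
  over.
rewrite -linear_sum -mulr_sumr.
under eq_bigr do rewrite mulrA.
rewrite sum_delta_mx_mul_delta_mx -mulmxE mul_mx_scalar !linearZ /=.
by rewrite colvalK.
Qed.

End SandwichMatrix.

(** * The sign matrix and the involution *)

Section OmegaTheory.
Variables (K : numClosedFieldType) (N : nat).
Local Notation Omega := (Omega K N).

Lemma mul_Omega_mx p (A : 'M[K]_(N ^ 2, p)) i j :
  (Omega *m A) i j = (-1) ^+ ((N * N.+1)./2 <= i)%N * A i j.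
Proof.
rewrite mxE (bigD1 i) //= big1 ?addr0 => [|k ki].
  by rewrite OmegaE eqxx mulr1.
by rewrite OmegaE eq_sym (negbTE ki) mulr0 mul0r.
Qed.

Lemma Omega_sqr : Omega *m Omega = 1%:M.
Proof.
by apply/matrixP => i j; rewrite mul_Omega_mx OmegaE mulrA -signr_addb addbb
  mul1r mxE.
Qed.

Lemma conj_Omega : map_mx Num.conj Omega = Omega.
Proof.
by apply/matrixP => i j; rewrite mxE OmegaE rmorphM rmorph_sign rmorph_nat.
Qed.

End OmegaTheory.

Section StarTheory.
Variables (K : numClosedFieldType) (A : starAlgType K).

Lemma star0 : star (0 : A) = 0.
Proof. by apply: (addrI (star (0 : A))); rewrite -starD !addr0. Qed.

Lemma star_sum (I : Type) (r : seq I) (F : I -> A) :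
  star (\sum_(i <- r) F i) = \sum_(i <- r) star (F i).
Proof. exact: (big_morph _ (@starD _ _) star0). Qed.

End StarTheory.

(** * The conditions of [Pert] in a signed basis *)

Section PertMatrix.
Variables (K : numClosedFieldType) (n : nat).
Local Notation M := 'M[K]_n.+1.
Local Notation N := n.+1.
Variable X : (N ^ 2).-tuple M.
Context (bX : basis_of fullv X) (X0 : X`_0 = 1).
Context (starX : forall i, (i < N ^ 2)%N ->
  star X`_i = (-1) ^+ ((N * N.+1)./2 <= i)%N *: X`_i).

Lemma colvec1 : colvec X 1 = e1 K N.
Proof.
have N2 : (0 < N ^ 2)%N by rewrite expn_gt0.
apply/matrixP => i j; rewrite !mxE -X0.
rewrite (coord_free (Ordinal N2) i (basis_free bX)).
by rewrite -val_eqE eq_sym.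
Qed.

(** Antilinearity conjugates the coordinates, and the antihermitian basis vectors contribute the
    signs. *)
Lemma colvec_star v :
  colvec X (star v) = Omega K N *m map_mx Num.conj (colvec X v).
Proof.
apply/matrixP => i j; rewrite mul_Omega_mx !mxE.
rewrite [v in LHS](coord_basis bX (memvf v)) star_sum.
under eq_bigr do rewrite starZ starX // scalerA.
by rewrite coord_sum_free ?(basis_free bX) // mulrC.
Qed.

(** If the sum on the right acts by [phi], the one on the left acts by [v |-> star (phi (star v))];
    two uses of [colvec_star] give its matrix. *)
Lemma tensor_mx_star (s : seq (M * M)) :
  tensor_mx X (\sum_(p <- s) star p.2 ⊗ (star p.1)°) =
  Omega K N *m
    map_mx Num.conj (tensor_mx X (\sum_(p <- s) p.1 ⊗ p.2°)) *m Omega K N.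
Proof.
apply: (colvec_inj_mx bX) => v.
have := tensor_mx_sum_colvec bX [seq (star p.2, star p.1) | p <- s] v.
rewrite !big_map => ->.
transitivity (colvec X (star (\sum_(p <- s) p.1 * star v * p.2))).
  congr colvec; rewrite star_sum; apply: eq_bigr => p _.
  by rewrite !starM starK mulrA.
rewrite colvec_star -tensor_mx_sum_colvec // colvec_star !map_mxM.
rewrite conj_Omega !mulmxA; congr (_ *m _).
by apply/matrixP => i j; rewrite 2!mxE; apply: conjCK.
Qed.

(** Both conditions depend on [t] alone, so any decomposition serves as witness. Injectivity of
    [tensor_mx] turns symmetry into a matrix equation, and [Omega_sqr] moves [Omega] across it. *)
Lemma in_pertE t : in_pert t <-> in_mxpert (tensor_mx X t).
Proof.
have stab (A : 'M[K]_(N ^ 2)) : (Omega K N *m A == tensor_mx X t *m Omega K N)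
    = (tensor_mx X t == Omega K N *m A *m Omega K N).
  by apply/eqP/eqP => [->|->]; rewrite -!mulmxA Omega_sqr mulmx1.
have unit s : t = \sum_(p <- s) p.1 ⊗ p.2° ->
    (tensor_mx X t *m e1 K N == e1 K N) = (\sum_(p <- s) p.1 * p.2 == 1).
  move=> ->; rewrite -colvec1 tensor_mx_sum_colvec //.
  rewrite (inj_eq (can_inj (colvecK bX))).
  by under eq_bigr do rewrite mulr1.
split=> [[s [ts s1 tS]]|/andP[]].
  rewrite /in_mxpert (unit s ts) s1 eqxx stab; apply/eqP.
  by rewrite [in LHS]tS tensor_mx_star -ts.
have [s ts] := tensor_sumP t; rewrite (unit s ts) stab => /eqP s1 tS.
exists s; split=> //; apply: (can_inj (tensor_mxK bX)).
by rewrite tensor_mx_star -[in RHS]ts; apply/eqP.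
Qed.

Definition pert_mx (t : Pert M) : MxPert K N :=
  MkMxPert ((in_pertE t).1 (pertP t)).

Lemma pert_mxM : {morph pert_mx : t u / (t * u)%g}.
Proof. by move=> t u; apply: val_inj; apply: tensor_mxM. Qed.

Lemma pert_mx_bij : bijective pert_mx.
Proof.
have inv (A : MxPert K N) : `[< in_pert (mx_tensor X A) >].
  by apply/asboolP/in_pertE; rewrite mx_tensorK //; apply: valP.
exists (fun A => MkPert (inv A)) => [t|A]; apply: val_inj.
  exact: tensor_mxK.
exact: mx_tensorK.
Qed.

End PertMatrix.

Theorem proposition3p9 (R : realType) (n : nat) :
  exists f : {multiplicative Pert 'M[R[i]]_n.+1 -> MxPert R[i] n.+1},
    bijective f.
Proof.
(* [sgn] marks the antihermitian positions; position 0, meant for the identity, is hermitian because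
   [N] is positive. *)
pose N := n.+1; pose sgn i := ((N * N.+1)./2 <= i)%N.
have sgn0 : sgn 0 = false by rewrite /sgn leqNgt half_gt0.
have [|||||X [bX X0 starX]] :=
  @sign_eigenbasis _ 'M[R[i]]_n.+1 (@star _ _) sgn 1.
- exact: starD.
- exact: starZ.
- exact: starK.
- exact: oner_neq0.
- by rewrite star1 sgn0 scale1r.
have dM : \dim {:'M[R[i]]_n.+1} = (N ^ 2)%N by rewrite dimvf dim_matrix.
rewrite dM in X bX X0 starX.
exists (HB.pack_for {multiplicative Pert 'M[R[i]]_n.+1 -> MxPert R[i] n.+1}
  (pert_mx bX X0 starX) (isMultiplicative.Build _ _ _ (pert_mxM bX X0 starX))).
exact: pert_mx_bij.
Qed.
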